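(* Let $\mathcal{M}=(X,\leq,V)$ and $\mathcal{M}'=(X',\leq',V')$ be intuitionistic Kripke models that are both image-compact for $\mathsf{Int}$, and let $x\in X$, $x'\in X'$. Then $x$ and $x'$ are $\mathsf{Int}$-bisimilar if and only if they satisfy exactly the same $\mathsf{Int}$-formulae (i.e. for all $\phi\in\mathsf{Int}$: $\mathcal{M},x\Vdash\phi \iff \mathcal{M}',x'\Vdash\phi$).
   Context: Fix a set $\mathrm{Prop}$ of propositional variables. $\mathsf{Int}$ is the set of formulae $\phi ::= \top\mid\bot\mid p\mid \phi\wedge\phi\mid\phi\vee\phi\mid\phi\to\phi$ with $p\in\mathrm{Prop}$. An intuitionistic Kripke model is $(X,\leq,V)$ with $\leq$ a preorder (reflexive, transitive) on $X$ and $V$ assigning to each $p\in\mathrm{Prop}$ an upset of $(X,\leq)$. Truth: $x\Vdash\top$ always, $x\Vdash\bot$ never, $x\Vdash p$ iff $x\in V(p)$, $\wedge,\vee$ pointwise, $x\Vdash\phi\to\psi$ iff for all $y\geq x$, $y\Vdash\phi$ implies $y\Vdash\psi$. For upsets $a,b$ let $a\Rightarrow b=\{x\mid \forall y\geq x\,(y\in a\Rightarrow y\in b)\}$. A model is image-compact for $\mathsf{Int}$ if there exists a collection $A$ of upsets of $(X,\leq)$ containing $\emptyset$, $X$ and all $V(p)$, closed under finite unions, finite intersections and $\Rightarrow$, such that for every $x\in X$ the set ${\uparrow}x=\{y\mid x\leq y\}$ is compact in the topology $\tau_A$ generated by the subbase $A\cup\{X\setminus a\mid a\in A\}$. An $\mathsf{Int}$-bisimulation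 between $(X,\leq,V)$ and $(X',\leq',V')$ is a relation $B\subseteq X\times X'$ such that for all $(x,x')\in B$: (B1) for all $p$, $x\in V(p)$ iff $x'\in V'(p)$; (B2) if $x\leq y$ then there is $y'$ with $x'\leq' y'$ and $yBy'$; (B3) if $x'\leq' y'$ then there is $y$ with $x\leq y$ and $yBy'$. Two states are $\mathsf{Int}$-bisimilar if some $\mathsf{Int}$-bisimulation contains the pair. *)

(* Defs.v *)
From HB Require Import structures.
From mathcomp Require Import all_boot all_order.
From mathcomp Require Import boolp classical_sets functions filter topology.

Set Implicit Arguments.
Unset Strict Implicit.
Unset Printing Implicit Defensive.

Local Open Scope classical_set_scope.

Inductive Int (P : Type) : Type :=
| Top
| Bot
| Atom of P
| And of Int P & Int P
| Or of Int P & Int P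
| Imp of Int P & Int P.

Arguments Top {P}.
Arguments Bot {P}.

Definition upset (X : Type) (le : X -> X -> Prop) (a : set X) : Prop :=
  forall x y, le x y -> a x -> a y.

Record model (P : Type) := Model {
  world :> Type;
  mle : world -> world -> Prop;
  mle_refl : forall x, mle x x;
  mle_trans : forall x y z, mle x y -> mle y z -> mle x z;
  mval : P -> set world;
  mval_upset : forall p, upset mle (mval p)
}.

Fixpoint sat (P : Type) (M : model P) (x : M) (phi : Int P) : Prop :=
  match phi with
  | Top => True
  | Bot => False
  | Atom p => mval p x
  | And phi1 phi2 => sat x phi1 /\ sat x phi2
  | Or phi1 phi2 => sat x phi1 \/ sat x phi2
  | Imp phi1 phi2 => forall y : M, mle x y -> sat y phi1 -> sat y phi2
  end.

Definition heyting_imp (X : Type) (le : X -> X -> Prop) (a b : set X) : set X :=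
  [set x | forall y, le x y -> a y -> b y].

Definition up (X : Type) (le : X -> X -> Prop) (x : X) : set X :=
  [set y | le x y].

(* [tau_space A] is X equipped with the topology tau_A; [{classic X}] supplies
   the choiceType structure that topologicalType requires of its carrier. *)
Definition tau_space (X : Type) (A : set (set X)) : Type := {classic X}.

Definition tau_subbase (X : Type) (A : set (set X)) : set (set X) :=
  A `|` [set ~` a | a in A].

HB.instance Definition _ (X : Type) (A : set (set X)) :=
  Choice.copy (tau_space A) {classic X}.
HB.instance Definition _ (X : Type) (A : set (set X)) :=
  isSubBaseTopological.Build (tau_space A)
    (tau_subbase A : set (set (tau_space A))) id.

(* Closure under binary unions and intersections, together with [set0] and
   [setT] in A, is closure under all finite ones. *)
Definition image_compact (P : Type) (M : model P) : Prop :=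
  exists A : set (set M),
    (forall a, A a -> upset (@mle P M) a) /\
    A set0 /\ A setT /\ (forall p, A (mval p)) /\
    (forall a b, A a -> A b -> A (a `|` b)) /\
    (forall a b, A a -> A b -> A (a `&` b)) /\
    (forall a b, A a -> A b -> A (heyting_imp (@mle P M) a b)) /\
    (forall x : M, compact (up (@mle P M) x : set (tau_space A))).

Definition bisimulation (P : Type) (M M' : model P) (B : M -> M' -> Prop) : Prop :=
  forall (x : M) (x' : M'), B x x' ->
    (forall p, mval p x <-> mval p x') /\
    (forall y, mle x y -> exists y', mle x' y' /\ B y y') /\
    (forall y', mle x' y' -> exists y, mle x y /\ B y y').

Definition bisimilar (P : Type) (M M' : model P) (x : M) (x' : M') : Prop :=
  exists B : M -> M' -> Prop, bisimulation B /\ B x x'.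

(* Main.v *)
From mathcomp Require Import all_boot.
From mathcomp Require Import boolp classical_sets filter topology.
Require Import Defs.

(** Logical equivalence is itself a bisimulation. If [x] and [x'] are logically
    equivalent and [x <= y], then the formulae true at [y] and the negations of
    those false at [y] are finitely satisfiable in the upset of [x']: a
    conjunction [phi] of the former and a disjunction [psi] of the latter
    satisfy [x |/= phi -> psi], hence [x' |/= phi -> psi]. Truth sets are clopen
    in [tau_A], so compactness of that upset realises the whole type of [y]. *)

Set Implicit Arguments.
Unset Strict Implicit.
Unset Printing Implicit Defensive.

Local Open Scope classical_set_scope.

Lemma tau_subbase_open (X : Type) (A : set (set X)) (a : set (tau_space A)) :
  tau_subbase A a -> open a.
Proof.
move=> Aa; exists [set a]; last by rewrite bigcup_set1.
by move=> _ ->; exact: finI_from1.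
Qed.

(** Both [a] and its complement are subbasic open, so whichever contains [y] is a neighbourhood of
    [y] and must meet every member of [F]. *)
Lemma cluster_tau_mem (X : Type) (A : set (set X)) (F : set_system (tau_space A))
    (y : tau_space A) (a : set X) :
  A a -> cluster F y -> (F a -> a y) /\ (F (~` a) -> ~ a y).
Proof.
move=> Aa Fy; split=> [Fa|FNa ay].
- apply: contrapT => Nay.
  have [//|z [az Naz]] := Fy _ (~` a : set (tau_space A)) Fa.
    by apply: open_nbhs_nbhs; split=> //; apply: tau_subbase_open; right; exists a.
  exact: Naz az.
- have [//|z [Naz az]] := Fy _ (a : set (tau_space A)) FNa.
    by apply: open_nbhs_nbhs; split=> //; apply: tau_subbase_open; left.
  exact: Naz az.
Qed.

Section ImageCompact.
Variable P : Type.
Implicit Types M : model P.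

Definition logically_equivalent M M' (x : M) (x' : M') : Prop :=
  forall phi : Int P, sat x phi <-> sat x' phi.

Lemma bisimilar_logically_equivalent M M' (x : M) (x' : M') :
  bisimilar x x' -> logically_equivalent x x'.
Proof.
case=> B [bisB Bxx'] phi.
elim: phi x x' Bxx' => //= [p|f IHf g IHg|f IHf g IHg|f IHf g IHg] x x' Bxx'.
- by have [] := bisB _ _ Bxx'.
- by rewrite (IHf _ _ Bxx') (IHg _ _ Bxx').
- by rewrite (IHf _ _ Bxx') (IHg _ _ Bxx').
- have [_ [forth back]] := bisB _ _ Bxx'; split=> sfg.
  (* Transferring an implication from [x] to [x'] pulls successors of [x'] back to [x], so this
     direction needs [back] and the converse [forth]. *)
  + move=> y' /back [y [xy Byy']] /(IHf _ _ Byy') fy.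
    by apply/(IHg _ _ Byy'); exact: sfg fy.
  + move=> y /forth [y' [xy' Byy']] /(IHf _ _ Byy') fy'.
    by apply/(IHg _ _ Byy'); exact: sfg fy'.
Qed.

Lemma truth_set_mem M (A : set (set M)) :
  A set0 -> A setT -> (forall p, A (mval p)) ->
  (forall a b, A a -> A b -> A (a `|` b)) ->
  (forall a b, A a -> A b -> A (a `&` b)) ->
  (forall a b, A a -> A b -> A (heyting_imp (@mle P M) a b)) ->
  forall phi : Int P, A [set x : M | sat x phi].
Proof.
move=> A0 AT AV AU AI AH; elim=> [||p|f Af g Ag|f Af g Ag|f Af g Ag] //=.
- exact: AV.
- exact: AI Af Ag.
- exact: AU Af Ag.
- exact: AH Af Ag.
Qed.

(** The filter generated by the upset of [x'], the truth sets of formulae true at [y] and the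
    complements of those false at [y]. One pair replaces two finite lists, by conjunction and
    disjunction. *)
Definition type_filter M M' (y : M) (x' : M') : set_system M' :=
  [set S | exists phi psi, [/\ sat y phi, ~ sat y psi &
     forall y', mle x' y' -> sat y' phi -> ~ sat y' psi -> S y']].

Lemma type_filter_proper M M' (x y : M) (x' : M') :
  logically_equivalent x x' -> mle x y -> ProperFilter (type_filter y x').
Proof.
move=> eqxx' xy; split.
- case=> phi [psi [yphi Nypsi H]]; apply: Nypsi.
  (* If the empty set belongs to the filter, no successor of [x'] separates [phi] from [psi], so
     [x'] forces the implication. *)
  suff : sat x (Imp phi psi) by move=> /(_ y xy yphi).
  apply/eqxx' => y' xy' y'phi; apply: contrapT; exact: H.
- split.
  + by exists Top, Bot; split.
  + move=> S T [f [g [yf Nyg Sfg]]] [h [k [yh Nyk Thk]]].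
    exists (And f h), (Or g k); split=> //=; first by case.
    move=> y' xy' [y'f y'h] /not_orP [Ny'g Ny'k].
    by split; [exact: Sfg|exact: Thk].
  + move=> S T ST [f [g [yf Nyg Sfg]]]; exists f, g; split=> // y' *.
    by apply/ST/Sfg.
Qed.

Lemma logically_equivalent_forth M M' (x y : M) (x' : M') :
  image_compact M' -> logically_equivalent x x' -> mle x y ->
  exists y', mle x' y' /\ logically_equivalent y y'.
Proof.
case=> A [_ [A0 [AT [AV [AU [AI [AH Acpt]]]]]]] eqxx' xy.
have truthA := truth_set_mem A0 AT AV AU AI AH.
(* The pair [Top], [Bot] constrains nothing beyond lying above [x']. *)
have Fup : type_filter y x' (up (@mle P M') x') by exists Top, Bot; split.
have [y' [xy' Fy']] := Acpt x' _ (type_filter_proper eqxx' xy) Fup.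
exists y'; split=> // phi; have [Fpos Fneg] := cluster_tau_mem (truthA phi) Fy'.
split=> [yphi|]; first by apply: Fpos; exists phi, Bot; split.
apply: contraPP => Nyphi; apply: Fneg.
by exists Top, phi; split.
Qed.

Lemma logically_equivalent_bisimulation M M' :
  image_compact M -> image_compact M' ->
  bisimulation (@logically_equivalent M M').
Proof.
move=> hM hM' x x' eqxx'; split; first by move=> p; exact: (eqxx' (Atom p)).
split=> [y xy|y' xy']; first exact: logically_equivalent_forth eqxx' xy.
(* The back condition is the forth condition with the models exchanged, now using compactness in
   [M]. *)
have eqx'x : logically_equivalent x' x by move=> phi; exact: iff_sym.
have [y [xy eqy'y]] := logically_equivalent_forth hM eqx'x xy'.
by exists y; split=> // phi; exact: iff_sym.
Qed.

End ImageCompact.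

Theorem theorem4p3 (P : Type) (M M' : model P)
  (hM : image_compact M) (hM' : image_compact M') (x : M) (x' : M') :
  bisimilar x x' <-> (forall phi : Int P, sat x phi <-> sat x' phi).
Proof.
split; first exact: bisimilar_logically_equivalent.
move=> eqxx'; exists (@logically_equivalent P M M'); split=> //.
exact: logically_equivalent_bisimulation.
Qed.
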